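(* Let $f,g$ be test quantities and $\phi$ a posterior family for a model $\pi$ with data space $Y$ and parameter space $\Theta$, and let $h_y:\mathbb{R}\to\mathbb{R}$, $y\in Y$, be measurable functions with $f(\theta,y)=h_y(g(\theta,y))$ for all $y\in Y$, $\theta\in\Theta$. If either $h_y$ is strictly increasing for all $y\in Y$, or $h_y$ is strictly decreasing for all $y\in Y$, then (1) $\phi$ passes continuous SBC with respect to $f$ if and only if $\phi$ passes continuous SBC with respect to $g$; and (2) for every $M\in\mathbb{N}$, $\phi$ passes $M$-sample SBC with respect to $f$ if and only if $\phi$ passes $M$-sample SBC with respect to $g$.
   Context: Model $\pi$: prior density $\pi_{\text{prior}}(\theta)$ on $\Theta$, observation density $\pi_{\text{obs}}(y\mid\theta)$ on $Y$, $\pi_{\text{marg}}(y)=\int_\Theta\pi_{\text{obs}}(y\mid\theta)\pi_{\text{prior}}(\theta)\,\mathrm{d}\theta$, $\pi_{\text{post}}(\theta\mid y)=\pi_{\text{obs}}(y\mid\theta)\pi_{\text{prior}}(\theta)/\pi_{\text{marg}}(y)$. A posterior family is $\phi:\Theta\times Y\to\mathbb{R}^+$ with $\int_\Theta\phi(\theta\mid y)\,\mathrm{d}\theta=1$ for all $y$; a test quantity is a measurable $f:\Theta\times Y\to\mathbb{R}$. Sample quantities: for $M\in\mathbb{N}$, $\theta_1,\dots,\theta_M$ i.i.d. from $\phi(\cdot\mid y)$, $N^{\mathtt{less}}=\sum_m\mathbb{I}[f(\theta_m,y)<f(\tilde\theta,y)]$, $N^{\mathtt{equals}}=\sum_m\mathbb{I}[f(\theta_m,y)=f(\tilde\theta,y)]$,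 $K$ uniform on $\{0,\dots,N^{\mathtt{equals}}\}$, $N^{\mathtt{total}}=N^{\mathtt{less}}+K$; $R_{\phi,f}(i\mid\tilde\theta,y)=\Pr(N^{\mathtt{total}}\le i)$; $Q_{\phi,f}(i\mid y)=\int_\Theta\pi_{\text{post}}(\tilde\theta\mid y)R_{\phi,f}(i\mid\tilde\theta,y)\,\mathrm{d}\tilde\theta$; $\phi$ passes $M$-sample SBC w.r.t. $f$ if $\int_YQ_{\phi,f}(i\mid y)\pi_{\text{marg}}(y)\,\mathrm{d}y=\frac{i+1}{M+1}$ for all $i\in\{0,\dots,M-1\}$. Continuous quantities: $C_{\phi,f}(s\mid y)=\int_\Theta\mathbb{I}[f(\theta,y)\le s]\phi(\theta\mid y)\,\mathrm{d}\theta$, $D_{\phi,f}(s\mid y)=\int_\Theta\mathbb{I}[f(\theta,y)=s]\phi(\theta\mid y)\,\mathrm{d}\theta$; with $U\sim\mathrm{uniform}[0,1]$, $r_{\phi,f}(x\mid\tilde\theta,y)=\Pr\big(C_{\phi,f}(f(\tilde\theta,y)\mid y)-U\,D_{\phi,f}(f(\tilde\theta,y)\mid y)\le x\big)$, $q_{\phi,f}(x\mid y)=\int_\Theta\pi_{\text{post}}(\tilde\theta\mid y)r_{\phi,f}(x\mid\tilde\theta,y)\,\mathrm{d}\tilde\theta$; $\phi$ passes continuous SBC w.r.t. $f$ if $\int_Yq_{\phi,f}(x\mid y)\pi_{\text{marg}}(y)\,\mathrm{d}y=x$ for all $x\in[0,1]$. *)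

(* Defs.v *)
From HB Require Import structures.
From mathcomp Require Import all_boot all_order all_algebra.
From mathcomp Require Import all_classical all_reals all_analysis.
Set Implicit Arguments. Unset Strict Implicit. Unset Printing Implicit Defensive.
Import Order.TTheory GRing.Theory Num.Theory.
Local Open Scope classical_set_scope.
Local Open Scope ring_scope.

Section SBC.
Context {R : realType} {dT dY : measure_display}
  {Theta : measurableType dT} {Y : measurableType dY}.
Variables (muT : {measure set Theta -> \bar R}) (muY : {measure set Y -> \bar R}).
(* the model pi: prior density on Theta, observation density obs y th = pi_obs(y|th) *)
Variables (prior : Theta -> R) (obs : Y -> Theta -> R).

Definition pi_marg (y : Y) : \bar R := (\int[muT]_th (obs y th * prior th)%:E)%E.

(* posterior density pi_post(th | y); real division, x / 0 = 0 *)
Definition pi_post (th : Theta) (y : Y) : R := obs y th * prior th / fine (pi_marg y).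

(* E over th_1..th_M i.i.d. with density p w.r.t. muT of F [:: th_1; ...; th_M]
   (iterated integral) *)
Fixpoint iid_int (p : Theta -> R) (M : nat) (F : seq Theta -> \bar R) : \bar R :=
  match M with
  | 0 => F [::]
  | M'.+1 => (\int[muT]_th ((p th)%:E * iid_int p M' (fun s => F (th :: s))))%E
  end.

Definition N_less (f : Theta -> Y -> R) (y : Y) (th0 : Theta) (s : seq Theta) : nat :=
  count (fun th => f th y < f th0 y) s.
Definition N_equals (f : Theta -> Y -> R) (y : Y) (th0 : Theta) (s : seq Theta) : nat :=
  count (fun th => f th y == f th0 y) s.

(* Pr_K (nl + K <= i) for K uniform on {0, ..., ne} *)
Definition prob_K (i nl ne : nat) : R :=
  (\sum_(k < ne.+1) ((nl + k <= i)%N)%:R) / (ne.+1)%:R.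

Definition R_sbc (phi : Theta -> Y -> R) (f : Theta -> Y -> R) (M i : nat)
    (th0 : Theta) (y : Y) : \bar R :=
  iid_int (fun th => phi th y) M
    (fun s => (prob_K i (N_less f y th0 s) (N_equals f y th0 s))%:E).

Definition Q_sbc (phi : Theta -> Y -> R) (f : Theta -> Y -> R) (M i : nat) (y : Y) : \bar R :=
  (\int[muT]_th0 ((pi_post th0 y)%:E * R_sbc phi f M i th0 y))%E.

Definition passes_M_SBC (phi : Theta -> Y -> R) (f : Theta -> Y -> R) (M : nat) : Prop :=
  forall i : nat, (i < M)%N ->
    (\int[muY]_y (Q_sbc phi f M i y * pi_marg y))%E = ((i.+1)%:R / (M.+1)%:R)%:E.

Definition C_sbc (phi : Theta -> Y -> R) (f : Theta -> Y -> R) (s : R) (y : Y) : \bar R :=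
  (\int[muT]_th ((if (f th y <= s)%R then phi th y else 0)%:E))%E.
Definition D_sbc (phi : Theta -> Y -> R) (f : Theta -> Y -> R) (s : R) (y : Y) : \bar R :=
  (\int[muT]_th ((if f th y == s then phi th y else 0)%:E))%E.

(* Pr_U (C - U D <= x), U uniform on [0,1] *)
Definition r_sbc (phi : Theta -> Y -> R) (f : Theta -> Y -> R) (x : R)
    (th0 : Theta) (y : Y) : \bar R :=
  (\int[lebesgue_measure]_(u in `[0%R, 1%R])
     (if (C_sbc phi f (f th0 y) y - u%:E * D_sbc phi f (f th0 y) y <= x%:E)%E then 1 else 0)%:E)%E.

Definition q_sbc (phi : Theta -> Y -> R) (f : Theta -> Y -> R) (x : R) (y : Y) : \bar R :=
  (\int[muT]_th0 ((pi_post th0 y)%:E * r_sbc phi f x th0 y))%E.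

Definition passes_cont_SBC (phi : Theta -> Y -> R) (f : Theta -> Y -> R) : Prop :=
  forall x : R, 0 <= x <= 1 ->
    (\int[muY]_y (q_sbc phi f x y * pi_marg y))%E = x%:E.

End SBC.

(* Main.v *)
Require Import Defs.
From HB Require Import structures.
From mathcomp Require Import all_boot all_order all_algebra.
From mathcomp Require Import all_classical all_reals all_analysis.
From mathcomp Require Import measurable_realfun.
From mathcomp Require Import zify ring lra.
Set Implicit Arguments. Unset Strict Implicit. Unset Printing Implicit Defensive.
Import Order.TTheory GRing.Theory Num.Theory.
Local Open Scope classical_set_scope.
Local Open Scope ring_scope.

(** A strictly increasing [h y] leaves every comparison between values of the test
    quantity unchanged, so all SBC quantities for [f] and [g] coincide.  A strictly
    decreasing one reverses them: [N_less] becomes [M - N_less - N_equals] and [C_f]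
    becomes [1 - C_g + D_g].  Hence [R_f(i) = 1 - R_g(M-1-i)], and, replacing [U] by
    [1 - U], [r_f(x) + r_g(1-x) >= 1] while [r_f(x) + r_g(w) <= 1] for [w < 1-x]
    (equality may fail when [D_g = 0], where [r] is a step function).  Averaging over the prior
    predictive distribution, which has total mass [1], and letting [w] tend to [1-x]
    yields the uniform law for [f] from that for [g]. *)

(** * Tie-broken ranks: the uniform variable [K] *)

Lemma prob_K_ge0 (R : realType) (i nl ne : nat) : 0 <= prob_K i nl ne :> R.
Proof. by rewrite /prob_K divr_ge0// sumr_ge0. Qed.

Lemma prob_K_le1 (R : realType) (i nl ne : nat) : prob_K i nl ne <= 1 :> R.
Proof.
rewrite /prob_K ler_pdivrMr ?ltr0n// mul1r -natr_sum ler_nat.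
rewrite -[leqRHS]card_ord -sum1_card; apply: leq_sum => k _; exact: leq_b1.
Qed.

(** Replacing [k] by [ne - k] turns the rank on the left into [M - nl - k], and [M - nl - k <= i] is
    the negation of [nl + k <= M - i.+1]. The two hypotheses keep the truncated subtractions
    exact. *)
Lemma prob_K_rev (R : realType) (M i nl ne : nat) :
  (i < M)%N -> (nl + ne <= M)%N ->
  prob_K i (M - (nl + ne)) ne = 1 - prob_K (M - i.+1) nl ne :> R.
Proof.
move=> iM nM; apply/eqP; rewrite -subr_eq0 opprB addrA subr_eq0; apply/eqP.
rewrite /prob_K -mulrDl (reindex_inj rev_ord_inj)/= -big_split/=.
rewrite (eq_bigr (fun=> 1)).
  by rewrite big_const_ord iter_addr_0 mulrV// unitfE pnatr_eq0.
move=> k _; rewrite -natrD; rewrite (_ : (_ + _)%N = 1%N)//.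
have := ltn_ord k; rewrite ltnS => kne.
case: leqP => h1; case: leqP => h2 //=; lia.
Qed.

(** * Randomised continuous ranks: the law of [c - U * d] *)

Section uniform_cdf.
Context {R : realType}.
Implicit Types c d x w : R.

(* The probability that [c - U * d <= x] for [U] uniform on [0, 1] and [d >= 0].
   The inverse is written as a real power, for which measurability is available. *)
Definition unif_cdf c d x : R :=
  if d == 0 then (c <= x)%R%:R else Num.max 0 (Num.min 1 (1 - (c - x) * d `^ (-1))).

Lemma integral_unif_cdf c d x : 0 <= d ->
  (\int[lebesgue_measure]_(u in `[0%R, 1%R])
     (if (c%:E - u%:E * d%:E <= x%:E)%E then 1 else 0)%:E = (unif_cdf c d x)%:E :> \bar R)%E.
Proof.
move=> d0; rewrite /unif_cdf; have [->|dn0] := eqVneq d 0.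
  rewrite (eq_integral (cst ((c <= x)%R%:R)%:E)).
    by rewrite integral_cst//= lebesgue_measure_itv/= lte_fin ltr01 oppr0 adde0 mule1.
  by move=> u _; rewrite mule0 sube0 lee_fin; case: ifP.
have dp : 0 < d by rewrite lt_neqAle eq_sym dn0.
rewrite powR_inv1//.
set a := (c - x) / d.
transitivity (\int[lebesgue_measure]_(u in `[0%R, 1%R])
    (\1_(`[a, +oo[%classic : set R) u)%:E : \bar R)%E.
  apply: eq_integral => u _; rewrite indicE mem_setE/= in_itv/= andbT.
  rewrite -[(c%:E - u%:E * d%:E)%E]/((c - (u : R) * d)%:E) lee_fin.
  by rewrite /a ler_pdivrMr// lerBlDr lerBlDl; case: ifP.
rewrite integral_indic//=.
(* The interval is empty for [a > 1] and all of [0, 1] for [a <= 0]: these two cases are the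
   clipping in [unif_cdf]. *)
have -> : `[a, +oo[ `&` `[0, 1] = `[Num.max a 0, 1]%classic.
  apply/seteqP; split => u /=; rewrite !in_itv/= ge_max andbT.
    by move=> [->].
  by move=> /andP[/andP[-> ->] ->].
rewrite lebesgue_measure_itv/= lte_fin -EFinB.
case: (leP a 0) => ?; case: (ltP _ 1) => ?; case: (leP 1 (1 - a)) => ?;
  case: (leP 0 _) => ?; congr (_%:E); lra.
Qed.

Lemma unif_cdf_ge0 c d x : 0 <= unif_cdf c d x.
Proof. by rewrite /unif_cdf; case: ifP => // _; rewrite le_max lexx. Qed.

Lemma unif_cdf_le1 c d x : unif_cdf c d x <= 1.
Proof.
rewrite /unif_cdf; case: ifP => _; first by case: (c <= x).
by rewrite ge_max ler01 ge_min lexx.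
Qed.

(** For [d > 0] the unclipped values add up to [1 - (1 - x - w) / d], and clipping to [0, 1] is
    monotone and commutes with [t] to [1 - t]. For [d = 0] both indicators being 1 would force
    [1 - x <= c <= w], which the strict bound on [w] excludes. *)
Lemma unif_cdf_rev_le c d x w : 0 <= d -> w < 1 - x ->
  unif_cdf (1 - c + d) d x + unif_cdf c d w <= 1.
Proof.
move=> d0 wx; rewrite /unif_cdf; have [->|dn0] := eqVneq d 0.
  by case: (leP (1 - c + 0) x) => h1; case: (leP c) => h2 //=; lra.
have dp : 0 < d by rewrite lt_neqAle eq_sym dn0.
rewrite powR_inv1//.
have : 1 - (1 - c + d - x) / d + (1 - (c - w) / d) <= 1.
  have -> : 1 - (1 - c + d - x) / d + (1 - (c - w) / d) = 1 - (1 - x - w) / d.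
    by field.
  by rewrite gerBl divr_ge0//; lra.
move: (1 - (1 - c + d - x) / d) (1 - (c - w) / d) => s t.
case: (leP 1 s) => ?; case: (leP 1 t) => ?; case: (leP 0 (1 : R)) => ?;
  case: (leP 0 s) => ?; case: (leP 0 t) => ?; lra.
Qed.

(** For [d > 0] the unclipped values add up to exactly 1. For [d = 0] at least one indicator is 1,
    and both are when [c = 1 - x]. *)
Lemma unif_cdf_rev_ge c d x : 0 <= d ->
  1 <= unif_cdf (1 - c + d) d x + unif_cdf c d (1 - x).
Proof.
move=> d0; rewrite /unif_cdf; have [->|dn0] := eqVneq d 0.
  by case: (leP (1 - c + 0) x) => h1; case: (leP c) => h2 //=; lra.
have dp : 0 < d by rewrite lt_neqAle eq_sym dn0.
rewrite powR_inv1//.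
have : 1 - (1 - c + d - x) / d + (1 - (c - (1 - x)) / d) = 1 by field.
move: (1 - (1 - c + d - x) / d) (1 - (c - (1 - x)) / d) => s t.
case: (leP 1 s) => ?; case: (leP 1 t) => ?; case: (leP 0 (1 : R)) => ?;
  case: (leP 0 s) => ?; case: (leP 0 t) => ?; lra.
Qed.

Lemma measurable_unif_cdf (disp : measure_display) (T : measurableType disp) (c d : T -> R) x :
  measurable_fun setT c -> measurable_fun setT d ->
  measurable_fun setT (fun t => unif_cdf (c t) (d t) x).
Proof.
move=> mc md; apply: measurable_fun_ifT.
- exact: measurable_fun_eqr.
- rewrite (_ : (fun t => _) = (fun t => if c t <= x then 1 else 0)); last first.
    by apply/funext => t; case: ifP.
  by apply: measurable_fun_ifT => //; exact: measurable_fun_ler.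
- apply: measurable_maxr => //; apply: measurable_minr => //.
  apply: measurable_funB => //; apply: measurable_funM.
    exact: measurable_funB.
  exact: (measurableT_comp (measurable_powR (-1))) md.
Qed.

End uniform_cdf.

(** * Iterated integrals over i.i.d. draws, by Boolean case splits *)

Lemma measurable_fun_bool2 (d d' : measure_display) (T : measurableType d)
    (T' : measurableType d') (H : bool -> bool -> T -> T') (a b : T -> bool) :
  measurable_fun setT a -> measurable_fun setT b ->
  (forall u v, measurable_fun setT (H u v)) ->
  measurable_fun setT (fun t => H (a t) (b t) t).
Proof.
move=> ma mb mH; rewrite (_ : (fun t => _) =
  (fun t => if a t then if b t then H true true t else H true false t
            else if b t then H false true t else H false false t)); last first.
  by apply/funext => t; case: (a t); case: (b t).
by do 2 (apply: measurable_fun_ifT => //).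
Qed.

Section iid_int_theory.
Context {R : realType} {dT : measure_display} {Theta : measurableType dT}.

Lemma eq_iid_int (mu : {measure set Theta -> \bar R}) (p : Theta -> R) (M : nat)
    (F G : seq Theta -> \bar R) :
  (forall s, size s = M -> F s = G s) -> iid_int mu p M F = iid_int mu p M G.
Proof.
elim: M F G => [|M IH] F G FG /=; first exact: FG.
apply: eq_integral => th _; congr (_ * _)%E; apply: IH => s sM.
by apply: FG; rewrite /= sM.
Qed.

Lemma iid_int_ge0 (mu : {measure set Theta -> \bar R}) (p : Theta -> R) (M : nat)
    (F : seq Theta -> \bar R) :
  (forall th, 0 <= p th) -> (forall s, 0 <= F s)%E -> (0 <= iid_int mu p M F)%E.
Proof.
move=> p0; elim: M F => [|M IH] F F0 //=.
by apply: integral_ge0 => th _; rewrite mule_ge0 ?lee_fin ?IH.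
Qed.

(** Letting the integrand see the sample only through two counts avoids a sigma-algebra on
    sequences. Peeling off one draw shifts the arguments of [G] by two Booleans, so only four inner
    integrals occur; each is measurable by induction, which is why [G] is generalised, and Tonelli
    integrates out the draw. *)
Lemma measurable_iid_int (mu : {sigma_finite_measure set Theta -> \bar R})
    (d : measure_display) (Z : measurableType d) (p : Z -> Theta -> R)
    (a b : Z -> Theta -> bool) (M : nat) (G : nat -> nat -> \bar R) :
  measurable_fun setT (fun x : Z * Theta => p x.1 x.2) ->
  measurable_fun setT (fun x : Z * Theta => a x.1 x.2) ->
  measurable_fun setT (fun x : Z * Theta => b x.1 x.2) ->
  (forall z th, 0 <= p z th) -> (forall m n, 0 <= G m n)%E ->
  measurable_fun setT
    (fun z => iid_int mu (p z) M (fun s => G (count (a z) s) (count (b z) s))).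
Proof.
move=> mp ma mb p0; elim: M G => [|M IH] G G0 /=; first exact: measurable_cst.
pose H (u v : bool) (z : Z) : \bar R :=
  iid_int mu (p z) M (fun s => G (u + count (a z) s)%N (v + count (b z) s)%N).
apply: (measurable_fun_fubini_tonelli_F
  (fun x : Z * Theta => ((p x.1 x.2)%:E * H (a x.1 x.2) (b x.1 x.2) x.1)%E)).
  apply: emeasurable_funM; first exact/measurable_EFinP.
  apply: (measurable_fun_bool2 (H := fun u v x => H u v x.1)) => // u v.
  by apply: measurableT_comp => //; apply: (IH (fun m n => G (u + m)%N (v + n)%N)).
by move=> x; rewrite mule_ge0 ?lee_fin// iid_int_ge0.
Qed.

(** Additivity of the integral and total mass 1 of [p], one draw at a time. As a function of the
    first draw, the inner integral takes at most four values, hence is measurable. *)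
Lemma iid_int_compl (mu : {measure set Theta -> \bar R}) (p : Theta -> R)
    (a b : Theta -> bool) (M : nat) (G G' : nat -> nat -> \bar R) :
  measurable_fun setT p -> measurable_fun setT a -> measurable_fun setT b ->
  (forall th, 0 <= p th) -> (\int[mu]_th (p th)%:E = 1)%E ->
  (forall m n, 0 <= G m n)%E -> (forall m n, 0 <= G' m n)%E ->
  (forall m n, G m n + G' m n = 1)%E ->
  (iid_int mu p M (fun s => G (count a s) (count b s)) +
   iid_int mu p M (fun s => G' (count a s) (count b s)) = 1)%E.
Proof.
move=> mp ma mb p0 p1; elim: M G G' => [|M IH] G G' G0 G'0 GG' /=; first exact: GG'.
have mH (K : nat -> nat -> \bar R) : measurable_fun setT (fun th => (p th)%:E *
    iid_int mu p M (fun s => K (a th + count a s)%N (b th + count b s)%N))%E.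
  apply: emeasurable_funM; first exact/measurable_EFinP.
  exact: (measurable_fun_bool2 (H := fun u v _ =>
    iid_int mu p M (fun s => K (u + count a s)%N (v + count b s)%N))).
have H0 (K : nat -> nat -> \bar R) th : (forall m n, 0 <= K m n)%E -> (0 <= (p th)%:E *
    iid_int mu p M (fun s => K (a th + count a s)%N (b th + count b s)%N))%E.
  by move=> K0; rewrite mule_ge0 ?lee_fin// iid_int_ge0.
rewrite -ge0_integralD//; [|by move=> ? _; exact: H0..].
rewrite -[RHS]p1; apply: eq_integral => th _.
rewrite -ge0_muleDr ?iid_int_ge0//.
rewrite (IH (fun m n => G (a th + m)%N (b th + n)%N)
            (fun m n => G' (a th + m)%N (b th + n)%N))//.
by rewrite mule1.
Qed.

End iid_int_theory.

(** * Marginal, posterior, and averages over the joint law of the model *)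

Section prior_predictive_mean.
Context {R : realType} {dT dY : measure_display}
  {Theta : measurableType dT} {Y : measurableType dY}.
Variables (muT : {sigma_finite_measure set Theta -> \bar R})
  (muY : {sigma_finite_measure set Y -> \bar R}).
Variables (prior : Theta -> R) (obs : Y -> Theta -> R).
Hypotheses (mprior : measurable_fun setT prior) (prior_ge0 : forall th, 0 <= prior th)
  (prior1 : (\int[muT]_th (prior th)%:E = 1)%E)
  (mobs : measurable_fun setT (fun p : Y * Theta => obs p.1 p.2))
  (obs_ge0 : forall y th, 0 <= obs y th)
  (obs1 : forall th, (\int[muY]_y (obs y th)%:E = 1)%E).
Local Notation marg := (pi_marg muT prior obs).
Local Notation post := (pi_post muT prior obs).

Lemma pi_marg_ge0 y : (0 <= marg y)%E.
Proof. by apply: integral_ge0 => th _; rewrite lee_fin mulr_ge0. Qed.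

Lemma pi_post_ge0 th y : 0 <= post th y.
Proof. by rewrite divr_ge0 ?mulr_ge0 ?fine_ge0 ?pi_marg_ge0. Qed.

Lemma measurable_joint :
  measurable_fun setT (fun x : Y * Theta => (obs x.1 x.2 * prior x.2)%:E).
Proof.
apply/measurable_EFinP; apply: measurable_funM => //.
exact: (measurableT_comp mprior).
Qed.

Lemma measurable_pi_marg : measurable_fun setT marg.
Proof.
apply: (measurable_fun_fubini_tonelli_F _ measurable_joint) => x.
by rewrite lee_fin mulr_ge0.
Qed.

Lemma measurable_pi_post : measurable_fun setT (fun x : Theta * Y => post x.1 x.2).
Proof.
rewrite (_ : (fun x => _) = (fun x : Theta * Y =>
    obs x.2 x.1 * prior x.1 * (fine (marg x.2)) `^ (-1))); last first.
  by apply/funext => x; rewrite powR_inv1 ?fine_ge0 ?pi_marg_ge0.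
apply: measurable_funM.
  apply: measurable_funM; last exact: (measurableT_comp mprior).
  exact: (measurableT_comp mobs (measurable_fun_pair measurable_snd measurable_fst)).
apply: (measurableT_comp (measurable_powR (-1))).
apply: (measurableT_comp (fine_measurable measurableT)).
exact: (measurableT_comp measurable_pi_marg).
Qed.

Lemma integral_pi_marg : (\int[muY]_y marg y = 1)%E.
Proof.
rewrite (fubini_tonelli _ measurable_joint); last first.
  by move=> x; rewrite lee_fin mulr_ge0.
rewrite -[RHS]prior1; apply: eq_integral => th _ /=.
under eq_integral do rewrite EFinM.
rewrite ge0_integralZr//= ?obs1 ?mul1e ?lee_fin//.
  apply/measurable_EFinP; exact: measurable_fun_pair1 mobs.
by move=> y _; rewrite lee_fin.
Qed.

(** Where the marginal is infinite, [fine] sends it to 0 and the posterior vanishes; such data must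
    be shown negligible. *)
Lemma pi_marg_fin_num_ae : {ae muY, forall y, setT y -> marg y \is a fin_num}.
Proof.
apply: integrable_ae => //; apply/integrableP; split; first exact: measurable_pi_marg.
under eq_integral do rewrite gee0_abs ?pi_marg_ge0//.
by rewrite integral_pi_marg ltry.
Qed.

(** Common shape of both SBC conditions: with [F] equal to [r_sbc] or [R_sbc], passing is by mere
    unfolding an equation for this mean. *)
Definition sbc_mean (F : Theta -> Y -> \bar R) : \bar R :=
  (\int[muY]_y ((\int[muT]_th ((post th y)%:E * F th y)) * marg y))%E.

Lemma measurable_sbc_mean (F : Theta -> Y -> \bar R) :
  measurable_fun setT (fun x : Theta * Y => F x.1 x.2) -> (forall th y, 0 <= F th y)%E ->
  measurable_fun setT (fun y => (\int[muT]_th ((post th y)%:E * F th y)) * marg y)%E.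
Proof.
move=> mF F0; apply: emeasurable_funM; last exact: measurable_pi_marg.
apply: (measurable_fun_fubini_tonelli_G
  (fun x : Theta * Y => (post x.1 x.2)%:E * F x.1 x.2)%E).
  by apply: emeasurable_funM => //; apply/measurable_EFinP; exact: measurable_pi_post.
by move=> x; rewrite mule_ge0 ?lee_fin ?pi_post_ge0.
Qed.

Lemma measurable_post_mul (F : Theta -> Y -> \bar R) y :
  measurable_fun setT (fun x : Theta * Y => F x.1 x.2) ->
  measurable_fun setT (fun th => (post th y)%:E * F th y)%E.
Proof.
move=> mF; apply: emeasurable_funM; last exact: (measurable_fun_pair1 y mF).
by apply/measurable_EFinP; exact: measurable_fun_pair1 measurable_pi_post.
Qed.

(** For a finite nonzero marginal the division in [pi_post] cancels against the weight [marg y]. At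
    a zero marginal the posterior does not have mass 1, but the weight is 0 too; infinite marginals
    form a null set. *)
Lemma sbc_mean_cst1 : sbc_mean (fun _ _ => 1%E) = 1%E.
Proof.
rewrite -[RHS]integral_pi_marg; apply: ge0_ae_eq_integral => //.
- by apply: (measurable_sbc_mean (F := fun _ _ => 1%E)).
- exact: measurable_pi_marg.
- move=> y _; rewrite mule_ge0 ?pi_marg_ge0// integral_ge0// => th _.
  by rewrite mule1 lee_fin pi_post_ge0.
- by move=> y _; exact: pi_marg_ge0.
apply: filterS pi_marg_fin_num_ae => y /(_ Logic.I) my _.
have [m0|mN0] := eqVneq (marg y) 0%E; first by rewrite m0 mule0.
have fm0 : fine (marg y) != 0 by rewrite fine_eq0.
under eq_integral do rewrite mule1 /pi_post EFinM.
rewrite ge0_integralZr//; last 3 first.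
- exact: (measurable_fun_pair2 y measurable_joint).
- by move=> th _; rewrite lee_fin mulr_ge0.
- by rewrite lee_fin invr_ge0 fine_ge0 ?pi_marg_ge0.
rewrite -/(marg y); case: (marg y) my fm0 => //= m _ m0.
by rewrite -!EFinM mulfVK.
Qed.

Lemma sbc_meanD (F G : Theta -> Y -> \bar R) :
  measurable_fun setT (fun x : Theta * Y => F x.1 x.2) -> (forall th y, 0 <= F th y)%E ->
  measurable_fun setT (fun x : Theta * Y => G x.1 x.2) -> (forall th y, 0 <= G th y)%E ->
  sbc_mean (fun th y => F th y + G th y)%E = (sbc_mean F + sbc_mean G)%E.
Proof.
move=> mF F0 mG G0; rewrite /sbc_mean.
have int0 (K : Theta -> Y -> \bar R) y : (forall th y, 0 <= K th y)%E ->
    (0 <= \int[muT]_th ((post th y)%:E * K th y))%E.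
  by move=> K0; apply: integral_ge0 => th _; rewrite mule_ge0 ?lee_fin ?pi_post_ge0.
rewrite -ge0_integralD//; last 4 first.
- by move=> y _; rewrite mule_ge0 ?pi_marg_ge0 ?int0.
- exact: measurable_sbc_mean.
- by move=> y _; rewrite mule_ge0 ?pi_marg_ge0 ?int0.
- exact: measurable_sbc_mean.
apply: eq_integral => y _; rewrite -ge0_muleDl ?int0//; congr (_ * _)%E.
rewrite -ge0_integralD//; last 4 first.
- by move=> th _; rewrite mule_ge0 ?lee_fin ?pi_post_ge0.
- exact: measurable_post_mul.
- by move=> th _; rewrite mule_ge0 ?lee_fin ?pi_post_ge0.
- exact: measurable_post_mul.
by apply: eq_integral => th _; rewrite ge0_muleDr.
Qed.

Lemma le_sbc_mean (F G : Theta -> Y -> \bar R) :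
  measurable_fun setT (fun x : Theta * Y => F x.1 x.2) -> (forall th y, 0 <= F th y)%E ->
  measurable_fun setT (fun x : Theta * Y => G x.1 x.2) ->
  (forall th y, F th y <= G th y)%E ->
  (sbc_mean F <= sbc_mean G)%E.
Proof.
move=> mF F0 mG FG.
have G0 th y : (0 <= G th y)%E by exact: le_trans (FG th y).
apply: ge0_le_integral => //.
- move=> y _; rewrite mule_ge0 ?pi_marg_ge0// integral_ge0// => th _.
  by rewrite mule_ge0 ?lee_fin ?pi_post_ge0.
- exact: measurable_sbc_mean.
- exact: measurable_sbc_mean.
move=> y _; rewrite lee_wpmul2r ?pi_marg_ge0//; apply: ge0_le_integral => //.
- by move=> th _; rewrite mule_ge0 ?lee_fin ?pi_post_ge0.
- exact: measurable_post_mul.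
- exact: measurable_post_mul.
by move=> th _; rewrite lee_wpmul2l ?lee_fin ?pi_post_ge0.
Qed.

(** * SBC quantities of a posterior family: measurability and bounds *)

Variable phi : Theta -> Y -> R.
Hypotheses (mphi : measurable_fun setT (fun p : Theta * Y => phi p.1 p.2))
  (phi_ge0 : forall th y, 0 <= phi th y)
  (phi1 : forall y, (\int[muT]_th (phi th y)%:E = 1)%E).

(** Covers [C_sbc] and [D_sbc] at the moving threshold [f th0 y], jointly in [th0] and [y]. *)
Lemma measurable_integral_phi_if (P : Theta -> Theta -> Y -> bool) :
  measurable_fun setT (fun x : (Theta * Y) * Theta => P x.2 x.1.1 x.1.2) ->
  measurable_fun setT (fun x : Theta * Y =>
    \int[muT]_th (if P th x.1 x.2 then phi th x.2 else 0)%:E)%E.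
Proof.
move=> mP; apply: (measurable_fun_fubini_tonelli_F (fun x : (Theta * Y) * Theta =>
  (if P x.2 x.1.1 x.1.2 then phi x.2 x.1.2 else 0)%:E)).
  apply/measurable_EFinP; apply: measurable_fun_ifT => //.
  apply: (measurableT_comp mphi (g := fun x : (Theta * Y) * Theta => (x.2, x.1.2))).
  by apply: measurable_fun_pair => //; exact: measurableT_comp.
by move=> x; rewrite lee_fin; case: ifP.
Qed.

Lemma measurable_fun_ler_cst (s : R) : measurable_fun setT (fun t : R => t <= s).
Proof. by apply: measurable_fun_ler; [exact: measurable_id|exact: measurable_cst]. Qed.

Lemma measurable_fun_eqr_cst (s : R) : measurable_fun setT (fun t : R => t == s).
Proof. by apply: measurable_fun_eqr; [exact: measurable_id|exact: measurable_cst]. Qed.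

Section test_quantity.
Variable f : Theta -> Y -> R.
Hypothesis mf : measurable_fun setT (fun p : Theta * Y => f p.1 p.2).
Local Notation C th0 y := (C_sbc muT phi f (f th0 y) y).
Local Notation D th0 y := (D_sbc muT phi f (f th0 y) y).

Lemma measurable_test_pair :
  measurable_fun setT (fun x : (Theta * Y) * Theta => f x.2 x.1.2) /\
  measurable_fun setT (fun x : (Theta * Y) * Theta => f x.1.1 x.1.2).
Proof.
split; last exact: (measurableT_comp mf).
apply: (measurableT_comp mf (g := fun x : (Theta * Y) * Theta => (x.2, x.1.2))).
by apply: measurable_fun_pair => //; exact: measurableT_comp.
Qed.

Lemma measurable_phi_if (P : pred R) y : measurable_fun setT P ->
  measurable_fun setT (fun th => (if P (f th y) then phi th y else 0)%:E).
Proof.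
move=> mP; apply/measurable_EFinP; apply: measurable_fun_ifT => //.
  by apply: (measurableT_comp mP); exact: (measurable_fun_pair1 y mf).
exact: (measurable_fun_pair1 y mphi).
Qed.

Lemma phi_if_le1 (P : pred R) y : measurable_fun setT P ->
  (0 <= \int[muT]_th (if P (f th y) then phi th y else 0)%:E <= 1)%E.
Proof.
move=> mP; apply/andP; split.
  by apply: integral_ge0 => th _; rewrite lee_fin; case: ifP.
rewrite -(phi1 y); apply: ge0_le_integral => //.
- by move=> th _; rewrite lee_fin; case: ifP.
- exact: measurable_phi_if.
- by apply/measurable_EFinP; exact: (measurable_fun_pair1 y mphi).
- by move=> th _; rewrite lee_fin; case: ifP.
Qed.

Lemma C_sbc_fin_num s y : C_sbc muT phi f s y \is a fin_num.
Proof.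
have /andP[? ?] := @phi_if_le1 (fun t => t <= s) y (measurable_fun_ler_cst s).
by rewrite ge0_fin_numE// (le_lt_trans _ (ltry 1)).
Qed.

Lemma D_sbc_fin_num s y : D_sbc muT phi f s y \is a fin_num.
Proof.
have /andP[? ?] := @phi_if_le1 (fun t => t == s) y (measurable_fun_eqr_cst s).
by rewrite ge0_fin_numE// (le_lt_trans _ (ltry 1)).
Qed.

Lemma D_sbc_ge0 s y : (0 <= D_sbc muT phi f s y)%E.
Proof. by apply: integral_ge0 => th _; rewrite lee_fin; case: ifP. Qed.

(** [C_sbc] and [D_sbc] are masses at most 1, so the probability over [U] can be computed in real
    numbers; measurability and the reversal inequalities are then read off [unif_cdf]. *)
Lemma r_sbcE x th0 y :
  r_sbc muT phi f x th0 y = (unif_cdf (fine (C th0 y)) (fine (D th0 y)) x)%:E.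
Proof.
rewrite -integral_unif_cdf ?fine_ge0 ?D_sbc_ge0//.
by rewrite !fineK ?C_sbc_fin_num ?D_sbc_fin_num.
Qed.

Lemma measurable_r_sbc x :
  measurable_fun setT (fun z : Theta * Y => r_sbc muT phi f x z.1 z.2).
Proof.
rewrite (_ : (fun z => _) = (fun z : Theta * Y =>
    (unif_cdf (fine (C z.1 z.2)) (fine (D z.1 z.2)) x)%:E)); last first.
  by apply/funext => z; rewrite r_sbcE.
have [m1 m2] := measurable_test_pair.
apply/measurable_EFinP; apply: measurable_unif_cdf;
  apply: (measurableT_comp (fine_measurable measurableT)).
- apply: (measurable_integral_phi_if (P := fun th th0 y => f th y <= f th0 y)).
  exact: measurable_fun_ler.
- apply: (measurable_integral_phi_if (P := fun th th0 y => f th y == f th0 y)).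
  exact: measurable_fun_eqr.
Qed.

Lemma r_sbc_ge0 x th0 y : (0 <= r_sbc muT phi f x th0 y)%E.
Proof. by rewrite r_sbcE lee_fin unif_cdf_ge0. Qed.

Lemma measurable_R_sbc M i :
  measurable_fun setT (fun z : Theta * Y => R_sbc muT phi f M i z.1 z.2).
Proof.
have [m1 m2] := measurable_test_pair.
apply: (measurable_iid_int muT (p := fun z : Theta * Y => phi ^~ z.2)
  (a := fun z th => f th z.2 < f z.1 z.2) (b := fun z th => f th z.2 == f z.1 z.2)
  M (G := fun nl ne => (prob_K i nl ne)%:E)) => //.
- apply: (measurableT_comp mphi (g := fun x : (Theta * Y) * Theta => (x.2, x.1.2))).
  by apply: measurable_fun_pair => //; exact: measurableT_comp.
- exact: measurable_fun_ltr.
- exact: measurable_fun_eqr.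
- by move=> m n; rewrite lee_fin prob_K_ge0.
Qed.

Lemma R_sbc_ge0 M i th0 y : (0 <= R_sbc muT phi f M i th0 y)%E.
Proof. by apply: iid_int_ge0 => // s; rewrite lee_fin prob_K_ge0. Qed.

End test_quantity.

(** * Order-reversing pairs of test quantities *)

Section order_reversal.
Variables f g : Theta -> Y -> R.
Hypotheses (mf : measurable_fun setT (fun p : Theta * Y => f p.1 p.2))
  (mg : measurable_fun setT (fun p : Theta * Y => g p.1 p.2))
  (fg : forall th th' y, (f th y <= f th' y) = (g th' y <= g th y)).

Lemma order_reversal_eq th th' y : (f th y == f th' y) = (g th y == g th' y).
Proof. by rewrite !eq_le !fg andbC. Qed.

Lemma order_reversal_lt th th' y : (f th y < f th' y) = (g th' y < g th y).
Proof. by rewrite !ltNge fg. Qed.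

Lemma D_sbc_rev th0 y :
  D_sbc muT phi f (f th0 y) y = D_sbc muT phi g (g th0 y) y.
Proof. by apply: eq_integral => th _; rewrite order_reversal_eq. Qed.

Lemma C_sbc_rev th0 y : fine (C_sbc muT phi f (f th0 y) y) =
  1 - fine (C_sbc muT phi g (g th0 y) y) + fine (D_sbc muT phi g (g th0 y) y).
Proof.
(* The two sublevel sets cover [Theta], overlapping exactly in the ties. The additive form postpones
   subtraction until all terms are known to be finite. *)
have h : (C_sbc muT phi f (f th0 y) y + C_sbc muT phi g (g th0 y) y =
    1 + D_sbc muT phi g (g th0 y) y)%E.
  have mle := measurable_fun_ler_cst; have meq := measurable_fun_eqr_cst.
  rewrite -(phi1 y) -!ge0_integralD//; do ?[by move=> th _; rewrite lee_fin//; case: ifP].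
  - apply: eq_integral => th _; rewrite fg -!EFinD; congr (_%:E).
    by case: (ltgtP (g th y) (g th0 y)) => _; rewrite ?addr0 ?add0r.
  - by apply/measurable_EFinP; exact: (measurable_fun_pair1 y mphi).
  - exact: (measurable_phi_if mg y (meq _)).
  - exact: (measurable_phi_if mf y (mle _)).
  - exact: (measurable_phi_if mg y (mle _)).
have cf := C_sbc_fin_num mf (f th0 y) y; have cg := C_sbc_fin_num mg (g th0 y) y.
have dg := D_sbc_fin_num mg (g th0 y) y.
move: h => /(congr1 fine); rewrite (fineD cf cg) (fineD _ dg)//.
by move=> /(canRL (addrK _)) ->; rewrite addrAC.
Qed.

Lemma r_sbc_rev_le x w th0 y : w < 1 - x ->
  (r_sbc muT phi f x th0 y + r_sbc muT phi g w th0 y <= 1)%E.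
Proof.
move=> wx; rewrite !r_sbcE// C_sbc_rev D_sbc_rev -EFinD lee_fin.
by rewrite unif_cdf_rev_le ?fine_ge0 ?D_sbc_ge0.
Qed.

Lemma r_sbc_rev_ge x th0 y :
  (1 <= r_sbc muT phi f x th0 y + r_sbc muT phi g (1 - x) th0 y)%E.
Proof.
rewrite !r_sbcE// C_sbc_rev D_sbc_rev -EFinD lee_fin.
by rewrite unif_cdf_rev_ge ?fine_ge0 ?D_sbc_ge0.
Qed.

Lemma R_sbc_rev M i th0 y : (i < M)%N ->
  (R_sbc muT phi f M i th0 y + R_sbc muT phi g M (M - i.+1) th0 y = 1)%E.
Proof.
move=> iM.
pose G nl ne : \bar R := (1 - prob_K (M - i.+1) nl ne)%:E.
have mgy : measurable_fun setT (g ^~ y) by exact: (measurable_fun_pair1 y mg).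
(* The integrand for [f] agrees with [G] of the counts for [g] only on samples of size [M]. *)
rewrite {1}/R_sbc (@eq_iid_int _ _ _ _ _ _ _ (fun s =>
    G (count (fun th => g th y < g th0 y) s) (count (fun th => g th y == g th0 y) s))).
  apply: (iid_int_compl _ (G' := fun nl ne => (prob_K (M - i.+1) nl ne)%:E)) => //.
  - exact: (measurable_fun_pair1 y mphi).
  - exact: measurable_fun_ltr.
  - exact: measurable_fun_eqr.
  - by move=> m n; rewrite lee_fin subr_ge0 prob_K_le1.
  - by move=> m n; rewrite lee_fin prob_K_ge0.
  - by move=> m n; rewrite -EFinD subrK.
move=> s sM; congr (_%:E).
set a := count _ s; set b := count _ s.
(* Trichotomy: a draw below the reference for [f] is one above it for [g], so the three counts
   exhaust the sample. *)
have ab : (N_less f y th0 s + (a + b) = M)%N.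
  rewrite -sM /N_less /a /b; elim: (s) => //= th t IH; rewrite order_reversal_lt.
  case: (ltgtP (g th y) (g th0 y)) => _ /=; lia.
have -> : N_equals f y th0 s = b by apply: eq_count => th; rewrite order_reversal_eq.
rewrite -(prob_K_rev _ iM); last by lia.
by congr prob_K; lia.
Qed.

Lemma passes_cont_SBC_rev :
  passes_cont_SBC muT muY prior obs phi g -> passes_cont_SBC muT muY prior obs phi f.
Proof.
move=> Pg x /andP[x0 x1].
change (sbc_mean (r_sbc muT phi f x) = x%:E).
have {}Pg w : 0 <= w <= 1 -> sbc_mean (r_sbc muT phi g w) = w%:E by exact: Pg.
have mr := fun w => measurable_r_sbc mf w; have mr' := fun w => measurable_r_sbc mg w.
have r0 := r_sbc_ge0 mf; have r0' := r_sbc_ge0 mg.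
have msum w : measurable_fun setT
    (fun z : Theta * Y => r_sbc muT phi f x z.1 z.2 + r_sbc muT phi g w z.1 z.2)%E.
  exact: emeasurable_funD.
have sum0 w th y : (0 <= r_sbc muT phi f x th y + r_sbc muT phi g w th y)%E.
  by rewrite adde_ge0.
(* Taking [w = 1 - x], where the mean for [g] is [1 - x]. *)
have lb : (x%:E <= sbc_mean (r_sbc muT phi f x))%E.
  have : (1 <= sbc_mean (r_sbc muT phi f x) + (1 - x)%:E)%E.
    rewrite -(Pg (1 - x)) -?sbc_meanD//; last by apply/andP; split; lra.
    rewrite -sbc_mean_cst1; apply: le_sbc_mean => // th y.
    exact: r_sbc_rev_ge.
  by case: (sbc_mean _) => [m| |]; rewrite ?leey// -EFinD !lee_fin; lra.
have ub w : 0 <= w < 1 - x -> (sbc_mean (r_sbc muT phi f x) + w%:E <= 1)%E.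
  move=> /andP[w0 w1]; rewrite -(Pg w) -?sbc_meanD//; last by apply/andP; split; lra.
  rewrite -[leRHS]sbc_mean_cst1; apply: le_sbc_mean => // th y.
  exact: r_sbc_rev_le.
(* Excludes an infinite mean and settles [x = 1], for which [ub] has no admissible [w]. *)
have ub1 : (sbc_mean (r_sbc muT phi f x) <= 1)%E.
  rewrite -[leRHS]sbc_mean_cst1; apply: le_sbc_mean => // th y.
  by rewrite r_sbcE// lee_fin unif_cdf_le1.
apply/eqP; rewrite eq_le lb andbT.
move: lb ub ub1; case: (sbc_mean _) => // m; rewrite !lee_fin => xm ub m1.
rewrite leNgt; apply/negP => mx.
(* If the mean [m] exceeded [x], lowering [w] below [1 - x] by half the gap would still leave
   [m + w = 1 + (m - x) / 2 > 1]. Nonnegativity of this [w] follows from [m <= 1]. *)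
have := ub (1 - x - (m - x) / 2); rewrite -EFinD lee_fin => h.
have : m + (1 - x - (m - x) / 2) <= 1 by apply: h; apply/andP; split; lra.
lra.
Qed.

Lemma passes_M_SBC_rev M :
  passes_M_SBC muT muY prior obs phi g M -> passes_M_SBC muT muY prior obs phi f M.
Proof.
move=> Pg i iM.
change (sbc_mean (R_sbc muT phi f M i) = (i.+1%:R / M.+1%:R)%:E).
have : sbc_mean (R_sbc muT phi g M (M - i.+1)) = ((M - i.+1).+1%:R / M.+1%:R)%:E.
  by apply: Pg; lia.
(* Finite-sample reversal is an exact identity, so no limiting argument is required. *)
have : (sbc_mean (R_sbc muT phi f M i) + sbc_mean (R_sbc muT phi g M (M - i.+1)) = 1)%E.
  rewrite -sbc_meanD; [|exact: measurable_R_sbc|exact: R_sbc_ge0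
    |exact: measurable_R_sbc|exact: R_sbc_ge0].
  rewrite -[RHS]sbc_mean_cst1; congr sbc_mean.
  by apply/funext => th; apply/funext => y; exact: R_sbc_rev.
move=> + gE; rewrite gE; case: (sbc_mean _) => // m; rewrite -EFinD => -[mE].
congr (_%:E); apply/(addIr _ (etrans mE _)).
(* The numerators are [i + 1] and [M - i], with sum [M + 1]. *)
rewrite -mulrDl -natrD (_ : (i.+1 + _)%N = M.+1) ?mulfV ?pnatr_eq0//; lia.
Qed.

End order_reversal.
End prior_predictive_mean.

(** * Order-preserving pairs of test quantities *)

Section order_embedding.
Context {R : realType} {dT dY : measure_display}
  {Theta : measurableType dT} {Y : measurableType dY}.
Variables (muT : {measure set Theta -> \bar R}) (muY : {measure set Y -> \bar R})
  (prior : Theta -> R) (obs : Y -> Theta -> R) (phi f g : Theta -> Y -> R).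
Hypothesis fg : forall th th' y, (f th y <= f th' y) = (g th y <= g th' y).

(** The SBC quantities use only comparisons between values at the same datum. This includes [C_sbc]
    and [D_sbc], since [r_sbc] evaluates them only at thresholds attained by the test quantity. *)
Lemma passes_SBC_order_embedding :
  (passes_cont_SBC muT muY prior obs phi f <-> passes_cont_SBC muT muY prior obs phi g) /\
  (forall M : nat,
     passes_M_SBC muT muY prior obs phi f M <-> passes_M_SBC muT muY prior obs phi g M).
Proof.
have fgeq th th' y : (f th y == f th' y) = (g th y == g th' y) by rewrite !eq_le !fg.
have fglt th th' y : (f th y < f th' y) = (g th y < g th' y) by rewrite !ltNge fg.
have CE th0 y : C_sbc muT phi f (f th0 y) y = C_sbc muT phi g (g th0 y) y.
  by apply: eq_integral => th _; rewrite fg.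
have DE th0 y : D_sbc muT phi f (f th0 y) y = D_sbc muT phi g (g th0 y) y.
  by apply: eq_integral => th _; rewrite fgeq.
have qE : q_sbc muT prior obs phi f = q_sbc muT prior obs phi g.
  apply/funext => x; apply/funext => y; apply: eq_integral => th0 _.
  by rewrite /r_sbc CE DE.
have QE : Q_sbc muT prior obs phi f = Q_sbc muT prior obs phi g.
  apply/funext => M; apply/funext => i; apply/funext => y; apply: eq_integral => th0 _.
  congr (_ * _)%E; apply: eq_iid_int => s _; congr (prob_K _ _ _)%:E.
    by apply: eq_count => th; rewrite fglt.
  by apply: eq_count => th; rewrite fgeq.
rewrite /passes_cont_SBC /passes_M_SBC qE QE.
by split=> [|M]; exact: iff_refl.
Qed.

End order_embedding.

(** * Bundling sigma-finite measures, and the two monotonicity cases *)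

Lemma sigma_finite_measureP (R : realType) (d : measure_display) (T : measurableType d)
    (mu : {measure set T -> \bar R}) : sigma_finite setT mu ->
  exists nu : {sigma_finite_measure set T -> \bar R}, mu = nu.
Proof.
case: mu => m c s.
pose nu : {sigma_finite_measure set T -> \bar R} :=
  HB.pack m (Measure.Pack c) (Measure_isSigmaFinite.Build _ _ _ (Measure.Pack c) s).
by exists nu; exact: eq_measure.
Qed.

Theorem theorem8 (R : realType) (dT dY : measure_display)
  (Theta : measurableType dT) (Y : measurableType dY)
  (muT : {measure set Theta -> \bar R}) (muY : {measure set Y -> \bar R})
  (prior : Theta -> R) (obs : Y -> Theta -> R)
  (phi f g : Theta -> Y -> R) (h : Y -> R -> R) :
  sigma_finite setT muT -> sigma_finite setT muY ->
  (* the model pi *)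
  measurable_fun setT prior -> (forall th, 0 <= prior th) ->
  (\int[muT]_th (prior th)%:E = 1)%E ->
  measurable_fun setT (fun p : Y * Theta => obs p.1 p.2) ->
  (forall y th, 0 <= obs y th) ->
  (forall th, \int[muY]_y (obs y th)%:E = 1)%E ->
  (* phi is a posterior family *)
  measurable_fun setT (fun p : Theta * Y => phi p.1 p.2) ->
  (forall th y, 0 <= phi th y) ->
  (forall y, \int[muT]_th (phi th y)%:E = 1)%E ->
  (* f, g test quantities *)
  measurable_fun setT (fun p : Theta * Y => f p.1 p.2) ->
  measurable_fun setT (fun p : Theta * Y => g p.1 p.2) ->
  (forall y, measurable_fun setT (h y)) ->
  (forall th y, f th y = h y (g th y)) ->
  ((forall y a b, a < b -> h y a < h y b) \/
   (forall y a b, a < b -> h y b < h y a)) ->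
  (passes_cont_SBC muT muY prior obs phi f <-> passes_cont_SBC muT muY prior obs phi g) /\
  (forall M : nat,
     passes_M_SBC muT muY prior obs phi f M <-> passes_M_SBC muT muY prior obs phi g M).
Proof.
move=> sT sY mprior prior0 prior1 mobs obs0 obs1 mphi phi0 phi1 mf mg _ fh [hinc|hdec].
  apply: passes_SBC_order_embedding => th th' y; rewrite !fh.
  by apply: le_mono => a b; exact: hinc.
(* Tonelli is stated for bundled sigma-finite measures, so both measures are replaced by equal
   bundled copies. *)
have [muT' muTE] := sigma_finite_measureP sT.
have [muY' muYE] := sigma_finite_measureP sY.
have fg th th' y : (f th y <= f th' y) = (g th' y <= g th y).
  by rewrite !fh; apply: le_nmono => a b; exact: hdec.
(* Reversal is symmetric in [f] and [g], so the one-way lemmas yield both directions of each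
   equivalence. *)
have gf th th' y : (g th y <= g th' y) = (f th' y <= f th y) by rewrite fg.
rewrite muTE in prior1 phi1 *; rewrite muYE in obs1 *.
split=> [|M]; split.
- exact: passes_cont_SBC_rev.
- exact: passes_cont_SBC_rev.
- exact: passes_M_SBC_rev.
- exact: passes_M_SBC_rev.
Qed.
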